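(* Let $\vec a(s_a)$ and $\vec b(s_b)$ be two Cartan framed null curves in Minkowski 3-space $E_1^3$, with frames $\{\vec\alpha_a,\vec\gamma_a,\vec\beta_a\}$, $\{\vec\alpha_b,\vec\gamma_b,\vec\beta_b\}$ and curvatures $\kappa_a,\kappa_b$. Then $\vec a(s_a)$ and $\vec b(s_b)$ are null similar curves with variable transformation if and only if the vectors $\vec\beta$ of the two curves are the same, i.e. $$\vec\beta_a(s_a)=\vec\beta_b(s_b),$$ under the particular variable transformation $$\lambda_b^a=\frac{\kappa_b}{\kappa_a}$$ of the arc lengths.
   Context: $E_1^3$ is $\mathbb R^3$ with the Lorentz metric $\langle\cdot,\cdot\rangle=-dx_1^2+dx_2^2+dx_3^2$ and vector product $\vec x\times\vec y=(x_2y_3-x_3y_2,\;x_1y_3-x_3y_1,\;x_2y_1-x_1y_2)$. A vector $\vec v\neq0$ is null if $\langle\vec v,\vec v\rangle=0$; a curve is null if all its velocity vectors are null. A Cartan framed null curve (null Frenet curve) $\vec a=\vec a(s)$ is a curve admitting a frame field $\{\vec\alpha,\vec\gamma,\vec\beta\}$ and functions $\kappa$ (curvature), $\tau$ (torsion) with $\vec\alpha=d\vec a/ds$, $\langle\vec\alpha,\vec\alpha\rangle=\langle\vec\gamma,\vec\gamma\rangle=0$, $\langle\vec\beta,\vec\beta\rangle=\langle\vec\alpha,\vec\gamma\rangle=1$, $\vec\beta=\vec\alpha\times\vec\gamma$, and $\vec\alpha'=\kappa\vec\beta$, $\vec\gamma'=\tau\vec\beta$, $\vec\beta'=-\tau\vec\alpha-\kappa\vec\gamma$,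 where $'=d/ds$. The parameter $s$ is called the arc length parameter. Subscripts $a$, $b$ indicate the data of $\vec a(s_a)$, $\vec b(s_b)$. Null similar curves with variable transformation $\lambda_b^a$: $\vec a(s_a)$ and $\vec b(s_b)$ are so called if there exists a variable transformation $s_a=\int\lambda_b^a(s_b)\,ds_b$ of the arc lengths such that $\vec\alpha_a(s_a)=\vec\alpha_b(s_b)$ for all corresponding values of the parameters. *)

(* Defs.v *)
From Stdlib Require Import Reals.
From Coquelicot Require Import Coquelicot.
Open Scope R_scope.

Definition E13 : Type := (R * R * R)%type.

Definition lorentz (x y : E13) : R :=
  let '(x1, x2, x3) := x in
  let '(y1, y2, y3) := y in
  - (x1 * y1) + x2 * y2 + x3 * y3.

Definition cross (x y : E13) : E13 :=
  let '(x1, x2, x3) := x in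
  let '(y1, y2, y3) := y in
  (x2 * y3 - x3 * y2, x1 * y3 - x3 * y1, x2 * y1 - x1 * y2).

(** The parameter ranges over the open, possibly unbounded interval
    [(lower, upper)]; the fields are total functions, but nothing is assumed
    about their values outside of that interval.  That [alpha s] is a nonzero
    null vector, and that the three vectors form a basis, follows from the
    scalar products. *)
Record cartan_framed_null_curve : Type := {
  lower : Rbar;
  upper : Rbar;
  dom (s : R) : Prop := Rbar_lt lower s /\ Rbar_lt s upper;
  pos : R -> E13;
  alpha : R -> E13;
  gamma : R -> E13;
  beta : R -> E13;
  kappa : R -> R;
  tau : R -> R;
  dom_nonempty : Rbar_lt lower upper;
  alpha_velocity : forall s, dom s -> is_derive pos s (alpha s);
  alpha_null : forall s, dom s -> lorentz (alpha s) (alpha s) = 0;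
  gamma_null : forall s, dom s -> lorentz (gamma s) (gamma s) = 0;
  beta_unit : forall s, dom s -> lorentz (beta s) (beta s) = 1;
  alpha_gamma : forall s, dom s -> lorentz (alpha s) (gamma s) = 1;
  beta_cross : forall s, dom s -> beta s = cross (alpha s) (gamma s);
  frenet_alpha : forall s, dom s ->
    is_derive alpha s (scal (kappa s) (beta s));
  frenet_gamma : forall s, dom s ->
    is_derive gamma s (scal (tau s) (beta s));
  frenet_beta : forall s, dom s ->
    is_derive beta s
      (plus (scal (- tau s) (alpha s)) (scal (- kappa s) (gamma s)))
}.

(** [s_a = phi s_b] is a variable transformation [s_a = int lambda ds_b] from
    the parameter interval of [b] onto that of [a].  Being a change of
    parameter, it is regular: [lambda] vanishes nowhere (its sign is not
    prescribed). *)
Definition variable_transformation (a b : cartan_framed_null_curve)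
    (lambda phi : R -> R) : Prop :=
  (forall s, dom b s -> continuous lambda s) /\
  (forall s, dom b s -> lambda s <> 0) /\
  (forall s0 s, dom b s0 -> dom b s ->
     is_RInt lambda s0 s (phi s - phi s0)) /\
  (forall s, dom b s -> dom a (phi s)) /\
  (forall t, dom a t -> exists s, dom b s /\ phi s = t).

Definition null_similar_curves (a b : cartan_framed_null_curve) : Prop :=
  exists lambda phi : R -> R,
    variable_transformation a b lambda phi /\
    (forall s, dom b s -> alpha a (phi s) = alpha b s).

(* Main.v *)
(** Differentiating the equality of the null tangents gives
    [lambda * kappa_a * beta_a = kappa_b * beta_b]; multiplying by [alpha],
    where [beta x alpha = alpha] for both frames, gives
    [lambda * kappa_a = kappa_b], and hence the [beta]s agree.

    Conversely, differentiating the equality of the [beta]s with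
    [lambda * kappa_a = kappa_b] gives an equation
    [p alpha_a + k gamma_a = q alpha_b + k gamma_b] with [k <> 0].  Since
    [alpha] and [gamma] are eigenvectors of [beta x _] for the eigenvalues
    [1] and [-1], the [gamma]s agree; and [gamma] and [beta] determine
    [alpha]. *)
Require Import Defs.
From Stdlib Require Import Reals Lra.
From Coquelicot Require Import Coquelicot.
Open Scope R_scope.

Lemma plus_E13 (x1 x2 x3 y1 y2 y3 : R) :
  plus ((x1, x2, x3) : E13) (y1, y2, y3) = (x1 + y1, x2 + y2, x3 + y3).
Proof. reflexivity. Qed.

Lemma scal_E13 (k x1 x2 x3 : R) :
  scal k ((x1, x2, x3) : E13) = (k * x1, k * x2, k * x3).
Proof. reflexivity. Qed.

Lemma E13_eq (x1 x2 x3 y1 y2 y3 : R) :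
  x1 = y1 -> x2 = y2 -> x3 = y3 -> (x1, x2, x3) = (y1, y2, y3) :> E13.
Proof. congruence. Qed.

Ltac coordinates :=
  repeat match goal with x : E13 |- _ => destruct x as [[? ?] ?] end;
  repeat progress (rewrite ?scal_E13, ?plus_E13; cbn [lorentz cross]);
  try apply E13_eq; ring.

Lemma lorentz_comm (x y : E13) : lorentz x y = lorentz y x.
Proof. coordinates. Qed.

Lemma lorentz_plus_l (x y z : E13) :
  lorentz (plus x y) z = lorentz x z + lorentz y z.
Proof. coordinates. Qed.

Lemma lorentz_scal_l (k : R) (x y : E13) :
  lorentz (scal k x) y = k * lorentz x y.
Proof. coordinates. Qed.

Lemma cross_plus_r (x y z : E13) :
  cross x (plus y z) = plus (cross x y) (cross x z).
Proof. coordinates. Qed.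

Lemma cross_scal_l (k : R) (x y : E13) :
  cross (scal k x) y = scal k (cross x y).
Proof. coordinates. Qed.

Lemma cross_scal_r (k : R) (x y : E13) :
  cross x (scal k y) = scal k (cross x y).
Proof. coordinates. Qed.

(** Triple product expansion; the Lorentz metric makes its sign opposite to the Euclidean one. *)
Lemma cross_cross (x y z : E13) :
  cross (cross x y) z =
  plus (scal (lorentz y z) x) (scal (- lorentz x z) y).
Proof. coordinates. Qed.

Lemma scal_E13_inj (k : R) (x y : E13) :
  k <> 0 -> scal k x = scal k y -> x = y.
Proof.
  destruct x as [[x1 x2] x3], y as [[y1 y2] y3].
  rewrite !scal_E13; intros hk [= h1 h2 h3].
  now rewrite (Rmult_eq_reg_l _ _ _ h1 hk), (Rmult_eq_reg_l _ _ _ h2 hk),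
    (Rmult_eq_reg_l _ _ _ h3 hk).
Qed.

Record null_frame (al ga be : E13) : Prop := {
  nf_alpha : lorentz al al = 0;
  nf_gamma : lorentz ga ga = 0;
  nf_alpha_gamma : lorentz al ga = 1;
  nf_beta : be = cross al ga
}.

Lemma cross_beta_alpha (al ga be : E13) :
  null_frame al ga be -> cross be al = al.
Proof.
  intros [ha _ hag ->].
  rewrite cross_cross, ha, (lorentz_comm ga al), hag; coordinates.
Qed.

Lemma cross_beta_gamma (al ga be : E13) :
  null_frame al ga be -> cross be ga = scal (-1) ga.
Proof.
  intros [_ hg hag ->].
  rewrite cross_cross, hg, hag; coordinates.
Qed.

Lemma null_frame_alpha_unique (al al' ga be : E13) :
  null_frame al ga be -> null_frame al' ga be -> al = al'.
Proof.
  intros [ha hg hag hb] [ha' _ hag' hb'].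
  (* [be x al'], computed with either expression of [be]. *)
  assert (h : al' = plus al (scal (- lorentz al al') ga)).
  { transitivity (cross be al').
    - symmetry; apply (cross_beta_alpha al' ga be); now split.
    - rewrite hb, cross_cross, (lorentz_comm ga al'), hag'; coordinates. }
  (* Pairing [h] with the null vector [al] shows that [lorentz al al'] equals its own negative. *)
  assert (h0 : 2 * lorentz al al' = 0).
  { remember (- lorentz al al') as t.
    assert (e : lorentz al al' = t).
    { rewrite h, lorentz_comm, lorentz_plus_l, lorentz_scal_l, ha,
        (lorentz_comm ga al), hag; ring. }
    lra. }
  rewrite h.
  replace (lorentz al al') with 0 by lra.
  coordinates.
Qed.

(** Meant for [c] the product of [lambda] with the curvature of [a], and [d] the curvature of [b].
    Crossing with the common [al] turns both sides into multiples of [al], whose coefficients are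
    read off by pairing with [ga]. *)
Lemma null_frame_beta_unique (c d : R) (al ga ga' be be' : E13) :
  null_frame al ga be -> null_frame al ga' be' -> c <> 0 ->
  scal c be = scal d be' -> c = d /\ be = be'.
Proof.
  intros hf hf' hc h.
  assert (e : c = d).
  { assert (hx : scal c al = scal d al).
    { rewrite <- (cross_beta_alpha _ _ _ hf) at 1.
      rewrite <- (cross_beta_alpha _ _ _ hf') at 2.
      now rewrite <- !cross_scal_l, h. }
    apply (f_equal (fun x => lorentz x ga)) in hx.
    rewrite !lorentz_scal_l, (nf_alpha_gamma _ _ _ hf) in hx; lra. }
  split; [exact e |].
  rewrite <- e in h; exact (scal_E13_inj _ _ _ hc h).
Qed.

Lemma null_frame_alpha_eq (p q k : R) (al al' ga ga' be : E13) :
  null_frame al ga be -> null_frame al' ga' be -> k <> 0 ->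
  plus (scal p al) (scal k ga) = plus (scal q al') (scal k ga') ->
  al = al'.
Proof.
  intros hf hf' hk h.
  (* The map taking [v] to [v] minus [cross be v] kills the eigenvalue 1 part and doubles the
     eigenvalue -1 part. It depends on [be] only, so it can be applied to both sides of [h]. *)
  assert (hx : forall r x y, null_frame x y be ->
            plus (plus (scal r x) (scal k y))
              (scal (-1) (cross be (plus (scal r x) (scal k y)))) =
            scal (2 * k) y).
  { intros r x y hxy.
    rewrite cross_plus_r, !cross_scal_r, (cross_beta_alpha _ _ _ hxy),
      (cross_beta_gamma _ _ _ hxy).
    clear; coordinates. }
  assert (e : ga = ga').
  { apply (scal_E13_inj (2 * k)); [lra |].
    rewrite <- (hx p al ga hf), <- (hx q al' ga' hf').
    exact (f_equal (fun v : E13 => plus v (scal (-1) (cross be v))) h). }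
  subst ga'; exact (null_frame_alpha_unique _ _ _ _ hf hf').
Qed.

Lemma is_derive_linear {U V : NormedModule R_AbsRing} (L : U -> V)
    (f : R -> U) (s : R) (l : U) :
  is_linear L -> is_derive f s l -> is_derive (fun t => L (f t)) s (L l).
Proof.
  intros hL hf.
  apply (filterdiff_ext_lin _ (fun y : R => L (scal y l))).
  - apply (filterdiff_comp' f L s); [exact hf | now apply filterdiff_linear].
  - intros y; exact (linear_scal L hL y l).
Qed.

(** The three coordinate projections are linear and separate points, which reduces uniqueness to
    real-valued functions. *)
Lemma is_derive_E13_unique (f : R -> E13) (s : R) (l m : E13) :
  is_derive f s l -> is_derive f s m -> l = m.
Proof.
  intros hl hm.
  assert (u : forall L : E13 -> R, is_linear L -> L l = L m).
  { intros L hL.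
    rewrite <- (is_derive_unique _ _ _ (is_derive_linear L f s l hL hl)).
    exact (is_derive_unique _ _ _ (is_derive_linear L f s m hL hm)). }
  assert (h1 := u _ (is_linear_comp _ _ is_linear_fst is_linear_fst)).
  assert (h2 := u _ (is_linear_comp _ _ is_linear_fst is_linear_snd)).
  assert (h3 := u _ is_linear_snd).
  destruct l as [[l1 l2] l3], m as [[m1 m2] m3]; cbn in h1, h2, h3.
  congruence.
Qed.

(** Lets an equality known only on the parameter interval be differentiated at each of its
    points. *)
Lemma locally_dom (c : cartan_framed_null_curve) (s : R) :
  dom c s -> locally s (dom c).
Proof.
  intros [hl hu]; apply filter_and.
  - now apply open_Rbar_gt.
  - now apply open_Rbar_lt.
Qed.

Lemma curve_null_frame (c : cartan_framed_null_curve) (s : R) :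
  dom c s -> null_frame (alpha c s) (gamma c s) (beta c s).
Proof.
  intros hs; split.
  - now apply alpha_null.
  - now apply gamma_null.
  - now apply alpha_gamma.
  - now apply beta_cross.
Qed.

(** Fundamental theorem of calculus with base point [s] itself: near [s], [phi t - phi s] is the
    integral of the continuous [lambda] from [s] to [t]. *)
Lemma variable_transformation_is_derive (a b : cartan_framed_null_curve)
    (lambda phi : R -> R) (s : R) :
  variable_transformation a b lambda phi -> dom b s ->
  is_derive phi s (lambda s).
Proof.
  intros (hc & _ & hI & _) hs.
  apply (is_derive_ext (fun t => (phi t - phi s) + phi s)).
  { intros t; change (phi t - phi s + phi s = phi t); ring. }
  replace (lambda s) with (lambda s + 0) by ring.
  apply (is_derive_plus (fun t => phi t - phi s) (fun _ => phi s)).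
  - apply (is_derive_RInt lambda _ s); [| now apply hc].
    apply (filter_imp (dom b)); [| now apply locally_dom].
    intros t ht; now apply hI.
  - exact (@is_derive_const R_AbsRing R_NormedModule (phi s) s).
Qed.

(** The chain rule, used for the fields [alpha] in one direction and [beta] in the other. *)
Lemma variable_transformation_derive_eq (a b : cartan_framed_null_curve)
    (lambda phi : R -> R) (f g : R -> E13) (s : R) (df dg : E13) :
  variable_transformation a b lambda phi ->
  (forall t, dom b t -> f (phi t) = g t) -> dom b s ->
  is_derive f (phi s) df -> is_derive g s dg ->
  scal (lambda s) df = dg.
Proof.
  intros hv hfg hs hf hg.
  apply (is_derive_E13_unique g s); [| exact hg].
  apply (is_derive_ext_loc (fun t => f (phi t))).
  - apply (filter_imp (dom b)); [exact hfg | now apply locally_dom].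
  - apply (is_derive_comp f phi); [exact hf |].
    now apply (variable_transformation_is_derive a b).
Qed.

Theorem theorem3p2 (a b : cartan_framed_null_curve)
    (hkappa : forall s, dom a s -> kappa a s <> 0) :
  null_similar_curves a b <->
  exists lambda phi : R -> R,
    variable_transformation a b lambda phi /\
    (forall s, dom b s -> lambda s = kappa b s / kappa a (phi s)) /\
    (forall s, dom b s -> beta a (phi s) = beta b s).
Proof.
  split; intros (lambda & phi & hv & h); exists lambda, phi;
    pose proof hv as (_ & hl & _ & hd & _).
  - assert (hs : forall s, dom b s ->
              lambda s * kappa a (phi s) = kappa b s /\
              beta a (phi s) = beta b s).
    { intros s hs.
      pose proof (curve_null_frame a (phi s) (hd s hs)) as hfa.
      rewrite (h s hs) in hfa.
      apply (null_frame_beta_unique _ _ _ _ _ _ _ hfa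
               (curve_null_frame b s hs)).
      - apply Rmult_integral_contrapositive_currified; auto.
      - rewrite <- (variable_transformation_derive_eq a b lambda phi _ _ s
                      _ _ hv h hs (frenet_alpha a _ (hd s hs))
                      (frenet_alpha b s hs)).
        clear; generalize (beta a (phi s)); intros; coordinates. }
    split; [exact hv | split; intros s hb; destruct (hs s hb) as [e1 e2]].
    + rewrite <- e1; field; auto.
    + exact e2.
  - destruct h as [hk hbeta].
    split; [exact hv | intros s hs].
    assert (ek : lambda s * kappa a (phi s) = kappa b s).
    { rewrite (hk s hs); field; auto. }
    pose proof (curve_null_frame a (phi s) (hd s hs)) as hfa.
    rewrite (hbeta s hs) in hfa.
    (* The coefficients come from the Frenet equations for [beta]; by [ek] both [gamma] terms carry
       the same factor [- kappa b s]. *)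
    apply (null_frame_alpha_eq (lambda s * - tau a (phi s)) (- tau b s)
             (- kappa b s) _ _ _ _ _ hfa (curve_null_frame b s hs)).
    (* The curvature of [b] is nonzero, as a product of the nonzero [lambda] and curvature of
       [a]. *)
    + rewrite <- ek; apply Ropp_neq_0_compat.
      apply Rmult_integral_contrapositive_currified; auto.
    + rewrite <- (variable_transformation_derive_eq a b lambda phi _ _ s
                    _ _ hv hbeta hs (frenet_beta a _ (hd s hs))
                    (frenet_beta b s hs)), <- ek.
      clear; generalize (alpha a (phi s)), (gamma a (phi s)); intros.
      coordinates.
Qed.
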